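(* Let $L$ be a completely distributive lattice, let $L^{L}$ be the complete lattice of all order-preserving maps $L\to L$ with the pointwise order, equipped with the quantale operation $(g\cdot f)(a)=\bigvee\{c\in L\mid \exists b\in L:\ b\triangleleft f(a)\text{ and } c\triangleleft g(b)\}$, and let $\mathcal{S}(L)$ be the quantale of all sup-preserving maps $L\to L$ (pointwise order) under the usual composition $\circ$. Then there exists a quantale nucleus $j$ on $(L^{L},\cdot)$ such that the quantales $(\mathcal{S}(L),\circ)$ and $((L^{L})_{j},\cdot_{j})$ are isomorphic.
   Context: In a complete lattice $P$, $x\triangleleft y$ ($x$ is wedge-below $y$) means that for every subset $A\subseteq P$ (possibly empty) with $y\leq\bigvee A$ there is $a\in A$ with $x\leq a$. A complete lattice $L$ is completely distributive if $x=\bigvee\{y\in L\mid y\triangleleft x\}$ for all $x\in L$. A map is sup-preserving if it preserves arbitrary suprema (including the empty one). A quantale is a complete lattice with an associative binary operation that distributes over arbitrary suprema in each variable; $(L^{L},\cdot)$ and $(\mathcal{S}(L),\circ)$ are quantales. A quantale homomorphism is a map preserving the binary operation and arbitrary suprema; an isomorphism is a bijective quantale homomorphism. A quantale nucleus on a quantale $(Q,\ast)$ is a map $j\colon Q\to Q$ such that for all $a,b\in Q$: (1) $a\leq j(a)$; (2) $a\leq b$ implies $j(a)\leq j(b)$; (3) $j(j(a))=j(a)$; (4) $j(a)\ast j(b)\leq j(a\ast b)$. Put $Q_j=\{q\in Q\mid j(q)=q\}$ with the induced order and $a\ast_j b=j(a\ast b)$ for $a,b\in Q_j$; then $(Q_j,\ast_j)$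 is a quantale. *)

(* Defs.v *)
From HB Require Import structures.
From mathcomp Require Import all_boot all_order all_classical.

Set Implicit Arguments.
Unset Strict Implicit.
Unset Printing Implicit Defensive.

Import Order.TTheory.

Local Open Scope classical_set_scope.
Local Open Scope order_scope.

(* [set T] is T -> Prop, so A ranges over all subsets, the empty one included;
   Sup is determined by the order. *)
HB.mixin Record POrder_isCompleteLattice d T of Order.POrder d T := {
  Sup : set T -> T;
  Sup_isLub : forall A : set T, isLub A (Sup A)
}.

#[short(type="completeLatticeType")]
HB.structure Definition CompleteLattice d :=
  {T of POrder_isCompleteLattice d T & Order.POrder d T}.

Section CompleteLatticeTheory.
Variables (d : Order.disp_t) (L : completeLatticeType d).
Implicit Types (x y z : L) (A B : set L).

Lemma Sup_ub A x : A x -> x <= Sup A.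
Proof. exact: (Sup_isLub A).1. Qed.

Lemma Sup_leP A y : Sup A <= y <-> forall x, A x -> x <= y.
Proof.
split=> [Ay x Ax|]; first exact: le_trans (Sup_ub Ax) Ay.
exact: (Sup_isLub A).2.
Qed.

Lemma Sup_isLub_eq A x : isLub A x -> Sup A = x.
Proof.
move=> [Ax xA]; apply/eqP; rewrite eq_le; apply/andP; split.
  exact/Sup_leP.
by apply: xA => y; exact: Sup_ub.
Qed.

Lemma le_SupS A B : (forall x, A x -> exists2 y, B y & x <= y) ->
  Sup A <= Sup B.
Proof.
by move=> AB; apply/Sup_leP => x /AB[y By xy]; exact: le_trans xy (Sup_ub By).
Qed.

Lemma eq_by_le x y : (forall z, x <= z <-> y <= z) -> x = y.
Proof. by move=> xy; apply/eqP; rewrite eq_le; apply/andP; split; apply/xy. Qed.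

Definition wedge_below x y :=
  forall A, y <= Sup A -> exists2 a, A a & x <= a.

End CompleteLatticeTheory.

Notation "x ◁ y" := (wedge_below x y) (at level 70, no associativity).

HB.mixin Record CompleteLattice_isCompletelyDistributive d L
    of CompleteLattice d L := {
  Sup_wedge_below : forall x : L, x = Sup [set y | y ◁ x]
}.

#[short(type="complDistrLatticeType")]
HB.structure Definition CompletelyDistributive d :=
  {L of CompleteLattice_isCompletelyDistributive d L & CompleteLattice d L}.

Section WedgeBelow.
Variables (d : Order.disp_t).

Lemma wedge_below_le (L : completeLatticeType d) (x y : L) : x ◁ y -> x <= y.
Proof. by move=> /(_ [set y])[|a ->//]; exact: Sup_ub. Qed.

Lemma wedge_below_le_trans (L : completeLatticeType d) (x y z : L) :
  x ◁ y -> y <= z -> x ◁ z.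
Proof. by move=> xy yz A zA; apply: xy; exact: le_trans yz zA. Qed.

Variable L : complDistrLatticeType d.
Implicit Types (x y z : L) (A : set L).

Lemma wedge_below_leP x z : x <= z <-> forall y, y ◁ x -> y <= z.
Proof. by rewrite {1}(Sup_wedge_below x); exact: Sup_leP. Qed.

Lemma wedge_below_dense x z : x ◁ z -> exists2 y, x ◁ y & y ◁ z.
Proof.
move=> /(_ [set w | exists2 y, w ◁ y & y ◁ z])[|w [y wy yz] xw].
  apply/wedge_below_leP => y yz; apply/wedge_below_leP => w wy.
  by apply: Sup_ub; exists y.
by exists y => // A /wy[a Aa wa]; exists a => //; exact: le_trans xw wa.
Qed.

Lemma wedge_below_SupP x A : x ◁ Sup A <-> exists2 a, A a & x ◁ a.
Proof.
split=> [/wedge_below_dense[y xy /(_ A)[//|a Aa ya]]|[a Aa xa]].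
  by exists a => //; exact: wedge_below_le_trans xy ya.
exact: wedge_below_le_trans xa (Sup_ub Aa).
Qed.

End WedgeBelow.

HB.mixin Record CompleteLattice_Semigroup_isQuantale d Q
    of CompleteLattice d Q & Semigroup Q := {
  mulg_Supl : forall (A : set Q) (b : Q),
    (Sup A * b)%g = Sup [set (a * b)%g | a in A];
  mulg_Supr : forall (a : Q) (B : set Q),
    (a * Sup B)%g = Sup [set (a * b)%g | b in B]
}.

#[short(type="quantaleType")]
HB.structure Definition Quantale d :=
  {Q of CompleteLattice_Semigroup_isQuantale d Q & CompleteLattice d Q
      & Semigroup Q}.

Lemma quantale_mul_le d (Q : quantaleType d) (a a' b b' : Q) :
  a <= a' -> b <= b' -> (a * b)%g <= (a' * b')%g.
Proof.
have Sup2 (x y : Q) : x <= y -> y = Sup [set x; y].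
  move=> xy; apply/esym/Sup_isLub_eq; split=> [_ [|] -> //|z]; apply.
  by right.
move=> /Sup2 aa' /Sup2 bb'; apply: (@le_trans _ _ (a' * b)%g).
  by rewrite aa' mulg_Supl; apply: Sup_ub; exists a => //; left.
by rewrite bb' mulg_Supr; apply: Sup_ub; exists b => //; left.
Qed.

HB.mixin Record isSupMorphism d (T : completeLatticeType d)
    d' (T' : completeLatticeType d') (f : T -> T') := {
  morph_Sup : forall A : set T, f (Sup A) = Sup (f @` A)
}.

HB.structure Definition SupMorphism d (T : completeLatticeType d)
    d' (T' : completeLatticeType d') :=
  {f of isSupMorphism d T d' T' f}.

Notation "{ 'supmorphism' T -> T' }" := (@SupMorphism.type _ T%type _ T'%type)
  (at level 0, T at level 98, T' at level 99,
   format "{ 'supmorphism'  T  ->  T' }") : type_scope.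

HB.structure Definition QuantaleMorphism d (Q : quantaleType d)
    d' (Q' : quantaleType d') :=
  {f of isSupMorphism d Q d' Q' f & @Multiplicative Q Q' f}.

Notation "{ 'qmorphism' Q -> Q' }" :=
  (@QuantaleMorphism.type _ Q%type _ Q'%type)
  (at level 0, Q at level 98, Q' at level 99,
   format "{ 'qmorphism'  Q  ->  Q' }") : type_scope.

Definition quantale_isomorphic d (Q : quantaleType d)
    d' (Q' : quantaleType d') : Prop :=
  exists f : {qmorphism Q -> Q'}, bijective f.

Section OMorphismOrder.
Variables (d d' : Order.disp_t) (T : porderType d) (T' : porderType d').
Implicit Types f g : {omorphism T -> T'}.

Lemma omorphism_inj : injective (fun f => f : T -> T').
Proof.
case=> f [[fm]] [g [[gm]]] /= fg; case: _ / fg gm => gm.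
by rewrite (Prop_irrelevance fm gm).
Qed.

HB.instance Definition _ := gen_eqMixin {omorphism T -> T'}.
HB.instance Definition _ := gen_choiceMixin {omorphism T -> T'}.

Definition le_omorphism f g := `[< forall x, f x <= g x >].

Fact le_omorphism_refl : reflexive le_omorphism.
Proof. by move=> f; apply/asboolP. Qed.

Fact le_omorphism_anti : antisymmetric le_omorphism.
Proof.
move=> f g /andP[/asboolP fg /asboolP gf]; apply: omorphism_inj.
by apply/funext => x; apply/eqP; rewrite eq_le fg gf.
Qed.

Fact le_omorphism_trans : transitive le_omorphism.
Proof.
move=> g f h /asboolP fg /asboolP gh; apply/asboolP => x.
exact: le_trans (fg x) (gh x).
Qed.

HB.instance Definition _ := Order.Le_isPOrder.Build d' {omorphism T -> T'}
  le_omorphism_refl le_omorphism_anti le_omorphism_trans.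

Lemma le_omorphismP f g : reflect (forall x, f x <= g x) (f <= g).
Proof. exact: asboolP. Qed.

End OMorphismOrder.

Section OMorphismCompleteLattice.
Variables (d d' : Order.disp_t) (T : porderType d).
Variable T' : completeLatticeType d'.
Implicit Type F : set {omorphism T -> T'}.

Fact Sup_omorphism_homo F :
  {homo (fun x => Sup [set f x | f in F]) : x y / x <= y}.
Proof.
move=> x y xy; apply: le_SupS => _ [f Ff <-]; exists (f y); first by exists f.
exact: omorph_le.
Qed.

Definition Sup_omorphism F : {omorphism T -> T'} :=
  HB.pack (fun x => Sup [set f x | f in F])
    (Order.isOrderMorphism.Build _ _ _ _ _ (@Sup_omorphism_homo F)).

Fact Sup_omorphism_isLub F : isLub F (Sup_omorphism F).
Proof.
split=> [f Ff|g Fg]; apply/le_omorphismP => x /=.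
  by apply: Sup_ub; exists f.
by apply/Sup_leP => _ [f /Fg/le_omorphismP fg <-]; exact: fg.
Qed.

HB.instance Definition _ := POrder_isCompleteLattice.Build d'
  {omorphism T -> T'} Sup_omorphism_isLub.

Lemma Sup_omorphismE F x : Sup F x = Sup [set f x | f in F].
Proof. by []. Qed.

End OMorphismCompleteLattice.

Section OMorphismQuantale.
Variables (d : Order.disp_t) (L : complDistrLatticeType d).
Implicit Types f g h : {omorphism L -> L}.

Fact wedge_mul_homo g f :
  {homo (fun a => Sup [set c | exists b, b ◁ f a /\ c ◁ g b]) : x y / x <= y}.
Proof.
move=> x y xy; apply: le_SupS => c [b [bx cb]]; exists c => //; exists b.
by split=> //; apply: wedge_below_le_trans bx _; exact: omorph_le.
Qed.

Definition wedge_mul g f : {omorphism L -> L} :=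
  HB.pack (fun a => Sup [set c | exists b, b ◁ f a /\ c ◁ g b])
    (Order.isOrderMorphism.Build _ _ _ _ _ (@wedge_mul_homo g f)).

Lemma wedge_mul_leP g f a z :
  wedge_mul g f a <= z <-> forall b, b ◁ f a -> g b <= z.
Proof.
split=> [/Sup_leP gfz b ba|gfz].
  by apply/wedge_below_leP => c cb; apply: gfz; exists b.
by apply/Sup_leP => c [b [/gfz + /wedge_below_le cb]]; exact: le_trans.
Qed.

Fact wedge_mulA : associative wedge_mul.
Proof.
move=> h g f; apply: omorphism_inj; apply/funext => a; apply: eq_by_le => z.
split=> /wedge_mul_leP hz; apply/wedge_mul_leP.
  move=> b ba; apply/wedge_mul_leP => c cb; apply: hz.
  have [c' cc' c'b] := wedge_below_dense cb.
  by apply/wedge_below_SupP; exists c' => //; exists b.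
move=> c /wedge_below_SupP[c' [b [/hz/wedge_mul_leP {}hz c'b] cc']].
exact/hz/(wedge_below_le_trans cc')/wedge_below_le.
Qed.

(* (g * f)%g is the operation g . f (f is applied first), not composition. *)
HB.instance Definition _ := isSemigroup.Build {omorphism L -> L} wedge_mulA.

Lemma mulg_omorphismE g f a :
  (g * f)%g a = Sup [set c | exists b, b ◁ f a /\ c ◁ g b].
Proof. by []. Qed.

Fact wedge_mul_Supl (G : set {omorphism L -> L}) f :
  (Sup G * f)%g = Sup [set (g * f)%g | g in G].
Proof.
apply: omorphism_inj; apply/funext => a; apply: eq_by_le => z; split.
  move=> /wedge_mul_leP Gz; apply/Sup_leP => _ [_ [g Gg <-] <-].
  apply/wedge_mul_leP => b /Gz/Sup_leP; apply.
  by exists g.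
move=> /Sup_leP Gz; apply/wedge_mul_leP => b ba; apply/Sup_leP.
move=> _ [g Gg <-]; have /wedge_mul_leP : (g * f)%g a <= z; last exact.
by apply: Gz; exists (g * f)%g => //; exists g.
Qed.

Fact wedge_mul_Supr g (F : set {omorphism L -> L}) :
  (g * Sup F)%g = Sup [set (g * f)%g | f in F].
Proof.
apply: omorphism_inj; apply/funext => a; apply: eq_by_le => z; split.
  move=> /wedge_mul_leP Fz; apply/Sup_leP => _ [_ [f Ff <-] <-].
  apply/wedge_mul_leP => b ba; apply: Fz.
  by apply/wedge_below_SupP; exists (f a) => //; exists f.
move=> /Sup_leP Fz; apply/wedge_mul_leP => b /wedge_below_SupP[_ [f Ff <-] ba].
have /wedge_mul_leP : (g * f)%g a <= z; last exact.
by apply: Fz; exists (g * f)%g => //; exists f.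
Qed.

HB.instance Definition _ := CompleteLattice_Semigroup_isQuantale.Build d
  {omorphism L -> L} wedge_mul_Supl wedge_mul_Supr.

End OMorphismQuantale.

Section SupMorphismOrder.
Variables (d d' : Order.disp_t).
Variables (T : completeLatticeType d) (T' : completeLatticeType d').
Implicit Types f g : {supmorphism T -> T'}.

Lemma supmorphism_inj : injective (fun f => f : T -> T').
Proof.
case=> f [[fm]] [g [[gm]]] /= fg; case: _ / fg gm => gm.
by rewrite (Prop_irrelevance fm gm).
Qed.

HB.instance Definition _ := gen_eqMixin {supmorphism T -> T'}.
HB.instance Definition _ := gen_choiceMixin {supmorphism T -> T'}.

Definition le_supmorphism f g := `[< forall x, f x <= g x >].

Fact le_supmorphism_refl : reflexive le_supmorphism.
Proof. by move=> f; apply/asboolP. Qed.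

Fact le_supmorphism_anti : antisymmetric le_supmorphism.
Proof.
move=> f g /andP[/asboolP fg /asboolP gf]; apply: supmorphism_inj.
by apply/funext => x; apply/eqP; rewrite eq_le fg gf.
Qed.

Fact le_supmorphism_trans : transitive le_supmorphism.
Proof.
move=> g f h /asboolP fg /asboolP gh; apply/asboolP => x.
exact: le_trans (fg x) (gh x).
Qed.

HB.instance Definition _ := Order.Le_isPOrder.Build d' {supmorphism T -> T'}
  le_supmorphism_refl le_supmorphism_anti le_supmorphism_trans.

Lemma le_supmorphismP f g : reflect (forall x, f x <= g x) (f <= g).
Proof. exact: asboolP. Qed.

Fact Sup_supmorphism_subproof (F : set {supmorphism T -> T'}) (A : set T) :
  Sup [set f (Sup A) | f in F] =
  Sup [set Sup [set f x | f in F] | x in A].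
Proof.
apply: eq_by_le => z; split=> /Sup_leP Fz; apply/Sup_leP.
  move=> _ [x Ax <-]; apply/Sup_leP => _ [f Ff <-].
  have /Sup_leP : Sup (f @` A) <= z.
    by rewrite -morph_Sup; apply: Fz; exists f.
  by apply; exists x.
move=> _ [f Ff <-]; rewrite morph_Sup; apply/Sup_leP => _ [x Ax <-].
have /Sup_leP : Sup [set f x | f in F] <= z by apply: Fz; exists x.
by apply; exists f.
Qed.

Definition Sup_supmorphism (F : set {supmorphism T -> T'}) :
    {supmorphism T -> T'} :=
  HB.pack (fun x => Sup [set f x | f in F])
    (isSupMorphism.Build _ _ _ _ _ (Sup_supmorphism_subproof F)).

Fact Sup_supmorphism_isLub F : isLub F (Sup_supmorphism F).
Proof.
split=> [f Ff|g Fg]; apply/le_supmorphismP => x /=.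
  by apply: Sup_ub; exists f.
by apply/Sup_leP => _ [f /Fg/le_supmorphismP fg <-]; exact: fg.
Qed.

HB.instance Definition _ := POrder_isCompleteLattice.Build d'
  {supmorphism T -> T'} Sup_supmorphism_isLub.

Lemma Sup_supmorphismE (F : set {supmorphism T -> T'}) x :
  Sup F x = Sup [set f x | f in F].
Proof. by []. Qed.

End SupMorphismOrder.

Section SupMorphismQuantale.
Variables (d : Order.disp_t) (L : completeLatticeType d).
Implicit Types f g h : {supmorphism L -> L}.

Fact comp_supmorphism_subproof g f (A : set L) :
  (g \o f) (Sup A) = Sup ((g \o f) @` A).
Proof. by rewrite /= !morph_Sup -image_comp. Qed.

Definition comp_supmorphism g f : {supmorphism L -> L} :=
  HB.pack (g \o f)
    (isSupMorphism.Build _ _ _ _ _ (comp_supmorphism_subproof g f)).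

Fact comp_supmorphismA : associative comp_supmorphism.
Proof. by move=> h g f; exact: supmorphism_inj. Qed.

HB.instance Definition _ :=
  isSemigroup.Build {supmorphism L -> L} comp_supmorphismA.

Lemma mulg_supmorphismE g f : (g * f)%g = g \o f :> (L -> L).
Proof. by []. Qed.

Fact comp_supmorphism_Supl (G : set {supmorphism L -> L}) f :
  (Sup G * f)%g = Sup [set (g * f)%g | g in G].
Proof.
apply: supmorphism_inj; apply/funext => x.
by rewrite Sup_supmorphismE image_comp.
Qed.

Fact comp_supmorphism_Supr g (F : set {supmorphism L -> L}) :
  (g * Sup F)%g = Sup [set (g * f)%g | f in F].
Proof.
apply: supmorphism_inj; apply/funext => x.
by rewrite mulg_supmorphismE /= morph_Sup !image_comp.
Qed.

HB.instance Definition _ := CompleteLattice_Semigroup_isQuantale.Build d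
  {supmorphism L -> L} comp_supmorphism_Supl comp_supmorphism_Supr.

End SupMorphismQuantale.

Record nucleus d (Q : quantaleType d) := Nucleus {
  nucleus_fun :> Q -> Q;
  nucleus_ge : forall a, a <= nucleus_fun a;
  nucleus_homo : {homo nucleus_fun : a b / a <= b};
  nucleus_idem : forall a, nucleus_fun (nucleus_fun a) = nucleus_fun a;
  nucleus_mul : forall a b,
    (nucleus_fun a * nucleus_fun b)%g <= nucleus_fun (a * b)%g
}.

Definition nucleus_fix d (Q : quantaleType d) (j : nucleus Q) : Type :=
  {q : Q | j q == q}.

Section NucleusFix.
Variables (d : Order.disp_t) (Q : quantaleType d) (j : nucleus Q).
Implicit Types (a b c : Q) (p q r : nucleus_fix j).

HB.instance Definition _ := SubChoice.on (nucleus_fix j).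
HB.instance Definition _ :=
  [SubChoice_isSubPOrder of nucleus_fix j by <: with d].

Fact nucleus_closed a : j (j a) == j a.
Proof. by rewrite nucleus_idem. Qed.

Definition nucleus_proj a : nucleus_fix j := exist _ (j a) (nucleus_closed a).

Lemma nucleus_fixE q : j (val q) = val q.
Proof. exact/eqP/(valP q). Qed.

Lemma le_nucleus_fixE p q : (p <= q) = (val p <= val q).
Proof. by []. Qed.

Lemma nucleus_leP a q : j a <= val q <-> a <= val q.
Proof.
split=> [|aq]; first exact/le_trans/nucleus_ge.
by rewrite -nucleus_fixE nucleus_homo.
Qed.

Fact Sup_nucleus_isLub (A : set (nucleus_fix j)) :
  isLub A (nucleus_proj (Sup (val @` A))).
Proof.
split=> [q Aq|q Aq]; rewrite le_nucleus_fixE /=.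
  by apply: le_trans (nucleus_ge _ _); apply: Sup_ub; exists q.
by apply/nucleus_leP/Sup_leP => _ [r Ar <-]; exact: Aq.
Qed.

HB.instance Definition _ := POrder_isCompleteLattice.Build d
  (nucleus_fix j) Sup_nucleus_isLub.

Definition nucleus_fix_mul p q := nucleus_proj (val p * val q)%g.

Lemma nucleus_mull a b : j (j a * b)%g = j (a * b)%g.
Proof.
apply/eqP; rewrite eq_le; apply/andP; split; last first.
  by apply/nucleus_homo/quantale_mul_le => //; exact: nucleus_ge.
rewrite -[leRHS]nucleus_idem; apply: nucleus_homo.
apply: le_trans (nucleus_mul j a b).
by apply: quantale_mul_le => //; exact: nucleus_ge.
Qed.

Lemma nucleus_mulr a b : j (a * j b)%g = j (a * b)%g.
Proof.
apply/eqP; rewrite eq_le; apply/andP; split; last first.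
  by apply/nucleus_homo/quantale_mul_le => //; exact: nucleus_ge.
rewrite -[leRHS]nucleus_idem; apply: nucleus_homo.
apply: le_trans (nucleus_mul j a b).
by apply: quantale_mul_le => //; exact: nucleus_ge.
Qed.

Fact nucleus_fix_mulA : associative nucleus_fix_mul.
Proof.
by move=> p q r; apply: val_inj; rewrite /= nucleus_mull nucleus_mulr mulgA.
Qed.

HB.instance Definition _ := isSemigroup.Build (nucleus_fix j) nucleus_fix_mulA.

Lemma val_nucleus_Sup (A : set (nucleus_fix j)) :
  val (Sup A) = j (Sup (val @` A)).
Proof. by []. Qed.

Lemma val_nucleus_mul p q : val (p * q)%g = j (val p * val q)%g.
Proof. by []. Qed.

Lemma nucleus_Sup (A : set Q) : j (Sup (j @` A)) = j (Sup A).
Proof.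
apply/eqP; rewrite eq_le; apply/andP; split.
  rewrite -[leRHS]nucleus_idem; apply/nucleus_homo/Sup_leP => _ [a Aa <-].
  exact/nucleus_homo/Sup_ub.
apply/nucleus_homo/le_SupS => a Aa; exists (j a); last exact: nucleus_ge.
by exists a.
Qed.

Fact nucleus_fix_mul_Supl (A : set (nucleus_fix j)) q :
  (Sup A * q)%g = Sup [set (p * q)%g | p in A].
Proof.
apply: val_inj; rewrite val_nucleus_mul !val_nucleus_Sup nucleus_mull mulg_Supl.
by rewrite -[LHS]nucleus_Sup !image_comp.
Qed.

Fact nucleus_fix_mul_Supr p (A : set (nucleus_fix j)) :
  (p * Sup A)%g = Sup [set (p * q)%g | q in A].
Proof.
apply: val_inj; rewrite val_nucleus_mul !val_nucleus_Sup nucleus_mulr mulg_Supr.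
by rewrite -[LHS]nucleus_Sup !image_comp.
Qed.

HB.instance Definition _ := CompleteLattice_Semigroup_isQuantale.Build d
  (nucleus_fix j) nucleus_fix_mul_Supl nucleus_fix_mul_Supr.

End NucleusFix.

(* Main.v *)
Require Import Defs.
From HB Require Import structures.
From mathcomp Require Import all_boot all_order all_classical.

(** A surjective quantale morphism [phi] with right adjoint [psi] satisfies
[phi \o psi = id], so [psi \o phi] is a nucleus and [psi] identifies the target
of [phi] with its fixpoints. Apply this to the map sending a monotone [f] to
[a |-> \/ {f b | b ◁ a}], the largest sup-preserving map below [f]; it turns the
product into composition because [g . f] is this coreflection of [g] composed
with [f]. *)

Set Implicit Arguments.
Unset Strict Implicit.
Unset Printing Implicit Defensive.

Import Order.TTheory.

Local Open Scope classical_set_scope.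
Local Open Scope order_scope.

Lemma Sup_down d (L : completeLatticeType d) (x : L) : Sup [set y | y <= x] = x.
Proof.
by apply: Sup_isLub_eq; split=> [y //|y]; apply; exact: lexx.
Qed.

(** For [x <= y], writing [y] as the supremum of its down-set makes [f x] one of the elements whose
    supremum is [f y]. *)
Lemma supmorphism_homo d (T : completeLatticeType d)
    d' (T' : completeLatticeType d') (f : {supmorphism T -> T'}) :
  {homo f : x y / x <= y}.
Proof.
by move=> x y xy; rewrite -(Sup_down y) morph_Sup; apply: Sup_ub; exists x.
Qed.

Section KernelNucleus.
Variables (d d' : Order.disp_t) (Q : quantaleType d) (Q' : quantaleType d').
Variable phi : {qmorphism Q -> Q'}.
Hypothesis phi_surj : forall s, exists a, phi a = s.
Implicit Types (a b : Q) (s t : Q').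

Definition radjoint s : Q := Sup [set a | phi a <= s].

(** Sup preservation gives the forward direction: [phi (radjoint s)] is a supremum of elements below
    [s]. *)
Lemma radjointP a s : a <= radjoint s <-> phi a <= s.
Proof.
split=> [/(supmorphism_homo phi)/le_trans|]; last exact: Sup_ub.
by apply; rewrite morph_Sup; apply/Sup_leP => _ [b bs <-].
Qed.

(** Surjectivity enters here: for [s = phi a], applying [phi] to [a <= radjoint (phi a)] gives
    [s <= phi (radjoint s)]. *)
Lemma radjointK : cancel radjoint phi.
Proof.
move=> s; apply/le_anti/andP; split; first exact/radjointP.
by have [a <-] := phi_surj s; apply/supmorphism_homo/radjointP.
Qed.

Lemma radjoint_homo : {homo radjoint : s t / s <= t}.
Proof. by move=> s t st; apply/radjointP; apply: le_trans st; exact/radjointP. Qed.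

Fact kernel_nucleus_mul a b :
  (radjoint (phi a) * radjoint (phi b))%g <= radjoint (phi (a * b)%g).
Proof. by apply/radjointP; rewrite !gmulfM /= !radjointK. Qed.

Definition kernel_nucleus : nucleus Q.
Proof.
exists (radjoint \o phi) => [a|a b ab|a|] /=; last exact: kernel_nucleus_mul.
- exact/radjointP.
- exact/radjoint_homo/supmorphism_homo.
- by rewrite radjointK.
Defined.

Fact radjoint_fix s : kernel_nucleus (radjoint s) == radjoint s.
Proof. by rewrite /= radjointK. Qed.

Definition radjoint_to_fix s : nucleus_fix kernel_nucleus :=
  exist _ (radjoint s) (radjoint_fix s).

(** A supremum of fixpoints is the supremum in [Q] closed by [radjoint \o phi], and [phi] sends the
    supremum of the [radjoint s] to that of the [s]. *)
Fact radjoint_to_fix_Sup (A : set Q') :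
  radjoint_to_fix (Sup A) = Sup (radjoint_to_fix @` A).
Proof.
apply: val_inj; rewrite val_nucleus_Sup /= morph_Sup !image_comp; congr radjoint.
congr Sup; rewrite -[LHS]image_id; apply: eq_imagel => s _ /=.
by rewrite radjointK.
Qed.

Fact radjoint_to_fix_mul :
  {morph radjoint_to_fix : s t / (s * t)%g >-> (s * t)%g}.
Proof.
by move=> s t; apply: val_inj; rewrite val_nucleus_mul /= gmulfM /= !radjointK.
Qed.

HB.instance Definition _ :=
  isSupMorphism.Build _ _ _ _ radjoint_to_fix radjoint_to_fix_Sup.
HB.instance Definition _ :=
  isMultiplicative.Build _ _ radjoint_to_fix radjoint_to_fix_mul.

Theorem kernel_nucleus_isomorphic :
  quantale_isomorphic Q' (nucleus_fix kernel_nucleus).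
Proof.
(* The inverse is [phi] restricted to fixpoints; the second cancellation is the fixpoint equation
   itself. *)
exists radjoint_to_fix; exists (phi \o val) => [s|q]; first exact: radjointK.
by apply: val_inj; exact: (nucleus_fixE q).
Qed.

End KernelNucleus.

Section SupCoreflection.
Variables (d : Order.disp_t) (L : complDistrLatticeType d).
Implicit Types (f g : {omorphism L -> L}) (s : {supmorphism L -> L}).

(** By interpolation, [b ◁ Sup A] holds exactly when [b ◁ a] for some [a] in [A], so both sides
    collect the same values [f b]. *)
Fact sup_coreflection_Sup f (A : set L) :
  Sup [set f b | b in [set b | b ◁ Sup A]] =
  Sup [set Sup [set f b | b in [set b | b ◁ a]] | a in A].
Proof.
apply: eq_by_le => z; split=> /Sup_leP fz; apply/Sup_leP.
  move=> _ [a Aa <-]; apply/Sup_leP => _ [b ba <-]; apply: fz; exists b => //.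
  by apply/wedge_below_SupP; exists a.
move=> _ [a /wedge_below_SupP[b Ab ab] <-].
have /Sup_leP : Sup [set f b | b in [set c | c ◁ b]] <= z.
  by apply: fz; exists b.
by apply; exists a.
Qed.

Definition sup_coreflection f : {supmorphism L -> L} :=
  HB.pack (fun a => Sup [set f b | b in [set b | b ◁ a]])
    (isSupMorphism.Build _ _ _ _ _ (sup_coreflection_Sup f)).

Lemma sup_coreflection_leP f a z :
  sup_coreflection f a <= z <-> forall b, b ◁ a -> f b <= z.
Proof.
split=> [/Sup_leP fz b ba|fz]; first by apply: fz; exists b.
by apply/Sup_leP => _ [b /fz ? <-].
Qed.

(** By complete distributivity the [c ◁ g b] have supremum [g b], which leaves the supremum of [g b]
    over [b ◁ f a]. *)
Lemma mulg_omorphism_coreflection g f a :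
  (g * f)%g a = sup_coreflection g (f a).
Proof.
apply: eq_by_le => z.
by split=> [/wedge_mul_leP/sup_coreflection_leP|/sup_coreflection_leP/wedge_mul_leP].
Qed.

Fact sup_coreflection_morph_Sup (F : set {omorphism L -> L}) :
  sup_coreflection (Sup F) = Sup (sup_coreflection @` F).
Proof.
apply: supmorphism_inj; apply/funext => a; apply: eq_by_le => z; split.
  move=> /sup_coreflection_leP Fz; apply/Sup_leP => _ [_ [f Ff <-] <-].
  apply/sup_coreflection_leP => b /Fz/Sup_leP; apply.
  by exists f.
move=> /Sup_leP Fz; apply/sup_coreflection_leP => b ba.
apply/Sup_leP => _ [f Ff <-].
have /sup_coreflection_leP : sup_coreflection f a <= z; last exact.
by apply: Fz; exists (sup_coreflection f) => //; exists f.
Qed.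

Fact sup_coreflection_mul :
  {morph sup_coreflection : g f / (g * f)%g >-> (g * f)%g}.
Proof.
move=> g f; apply: supmorphism_inj; apply/funext => a.
(* Being sup-preserving, [sup_coreflection g] moves inside the supremum of [f b] over [b ◁ a]; the
   sides then agree term by term. *)
rewrite mulg_supmorphismE /= -[RHS]/(sup_coreflection g (Sup _)) morph_Sup.
rewrite image_comp; congr Sup; apply: eq_imagel => b _.
exact: mulg_omorphism_coreflection.
Qed.

HB.instance Definition _ :=
  isSupMorphism.Build _ _ _ _ sup_coreflection sup_coreflection_morph_Sup.
HB.instance Definition _ :=
  isMultiplicative.Build _ _ sup_coreflection sup_coreflection_mul.

(** A sup-preserving map is monotone and is its own coreflection, since [a] is the supremum of the
    [b ◁ a]. *)
Lemma sup_coreflection_surj s : exists f, sup_coreflection f = s.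
Proof.
pose f : {omorphism L -> L} := HB.pack (s : L -> L)
  (Order.isOrderMorphism.Build _ _ _ _ _ (supmorphism_homo s)).
exists f; apply: supmorphism_inj; apply/funext => a /=.
by rewrite [in RHS](Sup_wedge_below a) morph_Sup.
Qed.

End SupCoreflection.

Theorem theorem3p16 (d : Order.disp_t) (L : complDistrLatticeType d) :
  exists j : nucleus {omorphism L -> L},
    quantale_isomorphic {supmorphism L -> L} (nucleus_fix j).
Proof.
exists (kernel_nucleus (@sup_coreflection_surj d L)).
exact: kernel_nucleus_isomorphic.
Qed.
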